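(* Setting and construction as in the context. Assume (i) $g$ is convex and Lipschitz continuous with Lipschitz constant $L_g\ge 0$, and (ii) for every $t\in[0,T]$ the set $\mathbb{W}(t)=B(t)\mathbb{U}\ominus(-E(t)\mathbb{D})$ is nonempty. Let $N\in\mathbb{N}$, levels $\gamma_1,\dots,\gamma_N\in g(\mathbb{R}^n)$, integers $n_k\in\mathbb{N}$, points $\bar x_{i,k}\in g^{-1}(\{\gamma_k\})$ ($1\le i\le n_k$), and controls $\omega_{i,k}\in\mathscr{W}[0,T]$ be given; let $\xi^\star_{i,k}$ be the solution on $[0,T]$ of $\dot\xi(s)=A(s)\xi(s)+\omega_{i,k}(s)$ a.e., $\xi(T)=\bar x_{i,k}$, let $\Omega^\star_k(t)=\mathrm{conv}(\{\xi^\star_{i,k}(t)\}_{i=1}^{n_k})$, and $$\bar v(t,x)=\min_{k\in\{1,\dots,N\}}\Big(L_g\inf_{\xi\in\Omega^\star_k(t)}\|\Phi_A(T,t)(x-\xi)\|+\gamma_k\Big).$$ Then $\bar v(t,x)\ge v(t,x)$ for all $(t,x)\in[0,T]\times\mathbb{R}^n$, where $v$ is the value function defined in the context.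
   Context: Fix $T>0$ and integers $n,m,\ell\ge 1$. Let $A\in C([0,T];\mathbb{R}^{n\times n})$, $B\in C([0,T];\mathbb{R}^{n\times m})$, $E\in C([0,T];\mathbb{R}^{n\times \ell})$, and let $\mathbb{U}\subset\mathbb{R}^m$, $\mathbb{D}\subset\mathbb{R}^\ell$ be compact, convex and nonempty; $g\in C(\mathbb{R}^n;\mathbb{R})$. For $0\le t\le T$, $\mathscr{U}[t,T]$ (resp. $\mathscr{D}[t,T]$) is the set of measurable maps $[t,T]\to\mathbb{U}$ (resp. $[t,T]\to\mathbb{D}$), and $\xi^{u,d}_{t,x}$ is the solution of $\dot\xi(s)=A(s)\xi(s)+B(s)u(s)+E(s)d(s)$ a.e. $s\in(t,T)$, $\xi(t)=x$. A map $\delta:\mathscr{U}[t,T]\to\mathscr{D}[t,T]$ is a non-anticipative strategy if for every $s\in[t,T]$ and $u_1,u_2\in\mathscr{U}[t,T]$, $u_1=u_2$ a.e. on $[t,s]$ implies $\delta[u_1]=\delta[u_2]$ a.e. on $[t,s]$; $\Delta[t,T]$ denotes the set of these. The value function is $v(t,x)=\sup_{\delta\in\Delta[t,T]}\inf_{u\in\mathscr{U}[t,T]}g(\xi^{u,\delta[u]}_{t,x}(T))$. $\Phi_A(s,\tau)$ is the state-transition matrix of $\dot y=A(s)y$. For $Y,Z\subseteq\mathbb{R}^n$: $Y\oplus Z=\{y+z\}$, $Y\ominus Z=\{c:\{c\}\oplus Z\subseteq Y\}$, $PY=\{Py:y\in Y\}$. $\mathscr{W}[t,T]$ is the set of measurable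 $\omega:[t,T]\to\mathbb{R}^n$ with $\omega(s)\in\mathbb{W}(s)$ for all $s$. *)

(* Defs.v *)
From HB Require Import structures.
From mathcomp Require Import all_boot all_order all_algebra.
From mathcomp Require Import all_classical all_reals all_analysis.
Set Implicit Arguments. Unset Strict Implicit. Unset Printing Implicit Defensive.
Import Order.TTheory GRing.Theory Num.Theory.
Import numFieldNormedType.Exports.
Local Open Scope classical_set_scope.
Local Open Scope ring_scope.

Definition enorm {R : realType} {n : nat} (v : 'cV[R]_n) : R :=
  Num.sqrt (\sum_(i < n) v i 0 ^+ 2).

Definition oint {R : realType} (a b : R) (f : R -> R) : R :=
  if a <= b then Rintegral (@lebesgue_measure R) `[a, b] f
  else - Rintegral (@lebesgue_measure R) `[b, a] f.

Definition is_convex_set {R : realType} {n : nat} (C : set 'cV[R]_n) : Prop :=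
  forall x y, C x -> C y -> forall lam : R, 0 <= lam <= 1 ->
    C (lam *: x + (1 - lam) *: y).

Definition is_convex_fun {R : realType} {n : nat} (f : 'cV[R]_n -> R) : Prop :=
  forall x y (lam : R), 0 <= lam <= 1 ->
    f (lam *: x + (1 - lam) *: y) <= lam * f x + (1 - lam) * f y.

Definition conv_hull {R : realType} {n : nat} (S : set 'cV[R]_n) : set 'cV[R]_n :=
  \bigcap_(C in [set C | is_convex_set C /\ S `<=` C]) C.

Definition mimage {R : realType} {p q : nat} (P : 'M[R]_(p, q)) (Y : set 'cV[R]_q)
  : set 'cV[R]_p := [set P *m y | y in Y].
Definition msum {R : realType} {p : nat} (Y Z : set 'cV[R]_p) : set 'cV[R]_p :=
  [set yz | exists y, exists z, Y y /\ Z z /\ yz = y + z].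
Definition mdiff {R : realType} {p : nat} (Y Z : set 'cV[R]_p) : set 'cV[R]_p :=
  [set c | msum [set c] Z `<=` Y].

Definition Wset {R : realType} {n m l : nat} (B : R -> 'M[R]_(n, m))
  (E : R -> 'M[R]_(n, l)) (U : set 'cV[R]_m) (D : set 'cV[R]_l) (t : R)
  : set 'cV[R]_n :=
  mdiff (mimage (B t) U) (mimage (- E t) D).

Definition admissible {R : realType} {p : nat} (t T : R) (V : R -> set 'cV[R]_p)
  (u : R -> 'cV[R]_p) : Prop :=
  (forall i : 'I_p, measurable_fun `[t, T] (fun s => u s i 0)) /\
  (forall s, t <= s <= T -> V s (u s)).

(* xi solves xi' = A xi + B u + E d a.e. on (t,T), xi(t) = x  (Caratheodory) *)
Definition is_traj {R : realType} {n m l : nat} (A : R -> 'M[R]_n)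
  (B : R -> 'M[R]_(n, m)) (E : R -> 'M[R]_(n, l)) (t T : R) (x : 'cV[R]_n)
  (u : R -> 'cV[R]_m) (d : R -> 'cV[R]_l) (xi : R -> 'cV[R]_n) : Prop :=
  {within `[t, T], continuous xi} /\
  forall s, t <= s <= T -> forall i : 'I_n,
    xi s i 0 = x i 0 + oint t s (fun r => (A r *m xi r + B r *m u r + E r *m d r) i 0).

Definition nonanticipative {R : realType} {m l : nat} (t T : R)
  (U : set 'cV[R]_m) (D : set 'cV[R]_l)
  (delta : (R -> 'cV[R]_m) -> (R -> 'cV[R]_l)) : Prop :=
  (forall u, admissible t T (fun _ => U) u -> admissible t T (fun _ => D) (delta u)) /\
  (forall s, t <= s <= T -> forall u1 u2,
     admissible t T (fun _ => U) u1 -> admissible t T (fun _ => U) u2 ->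
     {ae (@lebesgue_measure R), forall r, t <= r <= s -> u1 r = u2 r} ->
     {ae (@lebesgue_measure R), forall r, t <= r <= s -> delta u1 r = delta u2 r}).

Definition value {R : realType} {n m l : nat} (A : R -> 'M[R]_n)
  (B : R -> 'M[R]_(n, m)) (E : R -> 'M[R]_(n, l)) (U : set 'cV[R]_m)
  (D : set 'cV[R]_l) (g : 'cV[R]_n -> R) (T t : R) (x : 'cV[R]_n) : \bar R :=
  ereal_sup [set ereal_inf
      [set (g (xi T))%:E | xi in
         [set xi | exists u, admissible t T (fun _ => U) u /\ is_traj A B E t T x u (delta u) xi]]
    | delta in [set delta | nonanticipative t T U D delta]].

Definition is_state_transition {R : realType} {n : nat} (A : R -> 'M[R]_n) (T : R)
  (Phi : R -> R -> 'M[R]_n) : Prop :=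
  forall tau, 0 <= tau <= T ->
    {within `[0, T], continuous (fun s => Phi s tau)} /\
    forall s, 0 <= s <= T -> forall i j : 'I_n,
      Phi s tau i j = (1%:M : 'M[R]_n) i j + oint tau s (fun r => (A r *m Phi r tau) i j).

(* xi solves xi' = A xi + w a.e. on [0,T], xi(T) = xT *)
Definition is_backward_traj {R : realType} {n : nat} (A : R -> 'M[R]_n) (T : R)
  (xT : 'cV[R]_n) (w : R -> 'cV[R]_n) (xi : R -> 'cV[R]_n) : Prop :=
  {within `[0, T], continuous xi} /\
  forall s, 0 <= s <= T -> forall i : 'I_n,
    xi s i 0 = xT i 0 + oint T s (fun r => (A r *m xi r + w r) i 0).

Definition vbar {R : realType} {n N : nat} (Lg : R) (nk : 'I_N -> nat)
  (gam : 'I_N -> R) (xis : forall k : 'I_N, 'I_(nk k) -> R -> 'cV[R]_n)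
  (Phi : R -> R -> 'M[R]_n) (T t : R) (x : 'cV[R]_n) : \bar R :=
  ereal_inf [set (Lg%:E * ereal_inf
        [set (enorm (Phi T t *m (x - y)))%:E | y in conv_hull (range (fun i => xis k i t))]
        + (gam k)%:E)%E | k in [set: 'I_N]].

(* Main.v *)
(** The value is bounded by letting the control respond with a delay. Fix a strategy
    [delta], a measurable selection [w] of [W] and a solution [zeta] of
    [zeta' = A zeta + w]. Since [w - E d] always lies in [B U], a control could cancel
    the disturbance exactly if it knew [d]; it does not, because [delta[u]] may depend
    on the present value of [u], possibly discontinuously. So let the control answer
    with a delay [h]: [B (s - h) u(s)] approximates [w - E delta[u]] at time [s - h].
    Such a [u] is obtained after finitely many iterations, by non-anticipativity, and
    measurability is free because it suffices to choose among the points of a finite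
    net of [U]. Translating the integral by [h] and using the uniform continuity of
    [B], the defect [B u + E delta[u] - w] has a uniformly small primitive, so by
    Gronwall the terminal state is close to [zeta T + Phi T t (x - zeta t)]. The
    starting points [zeta t] of the solutions [zeta] with [g (zeta T) <= gamma_k] form
    a convex set containing all the [xis k i t], hence their convex hull, and the
    Lipschitz bound on [g] concludes. *)

Require Import Defs.
From HB Require Import structures.
From mathcomp Require Import all_boot all_order all_algebra.
From mathcomp Require Import all_classical all_reals all_analysis.
From mathcomp Require Import measurable_realfun ring lra.
Import Order.TTheory GRing.Theory Num.Theory.
Import numFieldNormedType.Exports.
Local Open Scope classical_set_scope.
Local Open Scope ring_scope.

Set Implicit Arguments.
Unset Strict Implicit.
Unset Printing Implicit Defensive.

(** * Preliminaries on norms and sequences *)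

Section real_line.
Context {R : realType}.
Implicit Types (a b c e x y : R).

Lemma subset_segment a b x y : a <= x -> y <= b -> `[x, y] `<=` `[a, b].
Proof. by move=> ax yb z /=; rewrite !in_itv/= => /andP[? ?]; lra. Qed.

Definition clamp a b x := Num.max a (Num.min x b).

Lemma clamp_itv a b x : a <= b -> a <= clamp a b x <= b.
Proof. by rewrite /clamp => ab; rewrite le_max lexx ge_max ge_min lexx ab orbT. Qed.

Lemma clamp_id a b x : a <= x <= b -> clamp a b x = x.
Proof. by move=> /andP[ax xb]; rewrite /clamp min_l// max_r. Qed.

Lemma dist_clamp_le a b x y : `|clamp a b x - clamp a b y| <= `|x - y|.
Proof.
by rewrite /clamp !minEle !maxEle; case: (leP x b); case: (leP y b);
  do ?[case: ifP]; move=> *; rewrite ler_norml; case: (ger0P (x - y)); lra.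
Qed.

Lemma exists_mul_le c e : 0 < e -> exists2 d, 0 < d & c * d <= e.
Proof.
move=> e0; have c1 : 0 < `|c| + 1 by rewrite ltr_wpDl.
exists (e / (`|c| + 1)); first exact: divr_gt0.
by rewrite mulrCA ler_piMr ?(ltW e0)// ler_pdivrMr// mul1r; have := ler_norm c; lra.
Qed.

End real_line.

Section sup_norm.
Context {R : realType}.

(* Completeness is inherited from the uniform structure; only the join is missing. *)
HB.instance Definition _ p q := NormedModule.on 'M[R]_(p, q).

Lemma norm_coord_le p q (F : 'M[R]_(p, q)) i j : `|F i j| <= `|F|.
Proof.
by rewrite [leRHS]/Num.Def.normr/= mx_normrE; exact: (le_bigmax _ _ (i, j)).
Qed.

Lemma mx_norm_le p q (F : 'M[R]_(p, q)) e : 0 <= e ->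
  (forall i j, `|F i j| <= e) -> `|F| <= e.
Proof.
move=> e0 Fe; rewrite [leLHS]/Num.Def.normr/= mx_normrE.
by apply/bigmax_leP; split => // -[i j] _; exact: Fe.
Qed.

Lemma norm_mulmx_le p q r (F : 'M[R]_(p, q)) (G : 'M[R]_(q, r)) :
  `|F *m G| <= q%:R * `|F| * `|G|.
Proof.
apply: mx_norm_le => [|i j]; first by rewrite !mulr_ge0.
rewrite mxE -mulrA; apply: le_trans (ler_norm_sum _ _ _) _.
apply: le_trans (_ : \sum_(k < q) `|F| * `|G| <= _); last first.
  by rewrite sumr_const card_ord mulr_natl.
by apply: ler_sum => k _; rewrite normrM ler_pM ?norm_coord_le.
Qed.

Lemma enorm_le_norm p (v : 'cV[R]_p) : enorm v <= Num.sqrt p%:R * `|v|.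
Proof.
rewrite -[`|v|]ger0_norm// -sqrtr_sqr -sqrtrM// /enorm ler_sqrt; last first.
  by rewrite mulr_ge0// sqr_ge0.
apply: le_trans (_ : \sum_(i < p) `|v| ^+ 2 <= _); last first.
  by rewrite sumr_const card_ord mulr_natl.
by apply: ler_sum => i _; rewrite -real_normK ?num_real// ler_sqr ?nnegrE// norm_coord_le.
Qed.

End sup_norm.

Section normed_modules.
Context {R : realType}.
Implicit Types e : R.

Lemma compact_norm_bounded (V : normedModType R) (K : set V) : compact K ->
  exists M, forall v, K v -> `|v| <= M.
Proof.
by move=> /compact_bounded[M [_ KM]]; exists (M + 1); apply: KM; rewrite ltrDl.
Qed.

Lemma compact_finite_net (V : normedModType R) (K : set V) e : compact K -> 0 < e ->
  exists2 s : seq V, {in s, forall v, K v} &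
    forall u, K u -> exists2 v, v \in s & `|v - u| <= e.
Proof.
rewrite compact_cover => cK e0.
have [|v Kv|s sK Ks] := cK _ K (fun v => (ball v e)°).
- by move=> v _; exact: open_interior.
- by exists v => //; exact: nbhsx_ballx.
exists (finmap.enum_fset s) => [v /sK|u /Ks[v /= vs /interior_subset uv]].
  by rewrite inE.
by exists v => //; apply: ltW; rewrite -ball_normE in uv.
Qed.

Lemma compact_unif_continuous (V W : normedModType R) (K : set V) (f : V -> W) e :
  compact K -> {within K, continuous f} -> 0 < e ->
  exists2 d, 0 < d & forall x y, K x -> K y -> `|x - y| < d -> `|f x - f y| <= e.
Proof.
move=> /compact_near_coveringP cK /subspace_continuousP cf e0.
have := cK _ (0 : R)^'+ (fun h x => forall y, K x -> K y -> `|x - y| < h ->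
  `|f x - f y| <= e).
case=> [x Kx|d /= d0 unif].
  have /cvgrPdist_le/(_ (e / 2)) := cf x Kx.
  rewrite divr_gt0// near_withinE => /(_ isT)/nbhs_normP[r /= r0 fr].
  exists (ball x (r / 2), [set h | h < r / 2]) => /=.
    split; first by apply: nbhsx_ballx; rewrite divr_gt0.
    by apply: nbhs_right_lt; rewrite divr_gt0.
  move=> [y h] [/= + hr] z Ky Kz yz; rewrite -ball_normE/= => xy.
  have fxy : `|f x - f y| <= e / 2 by apply: fr => //=; lra.
  have fxz : `|f x - f z| <= e / 2.
    by apply: fr => //=; apply: le_lt_trans (ler_distD y _ _) _; lra.
  by apply: le_trans (ler_distD (f x) _ _) _; rewrite (distrC (f y)); lra.
exists (d / 2) => [|x y Kx Ky xy]; first by rewrite divr_gt0.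
by apply: (unif (d / 2)) => //=; [rewrite sub0r normrN gtr0_norm; lra|lra].
Qed.

Lemma lipschitz_within_continuous (V W : normedModType R) (K : set V) (f : V -> W) L :
  (forall x y, K x -> K y -> `|f x - f y| <= L * `|x - y|) ->
  {within K, continuous f}.
Proof.
move=> fL; apply/subspace_continuousP => x Kx.
apply/cvgrPdist_le => e e0; rewrite near_withinE.
have [d d0 d_le] := exists_mul_le `|L| e0.
near=> y => Ky; apply: le_trans (fL x y Kx Ky) _; apply: le_trans d_le.
by apply: le_trans (ler_norm _) _; rewrite normrM normr_id ler_wpM2l.
Unshelve. all: by end_near. Qed.

End normed_modules.

Section sequences.
Context {R : realType}.

Lemma le_geometric_le0 (x C : R) : (forall k, x <= C / 2 ^+ k) -> x <= 0.
Proof.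
move=> xC; apply: (cvgr_to_ge (@cvg_geometric _ C 2^-1 _)).
  by rewrite ger0_norm//; lra.
by apply: nearW => k; rewrite /geometric/= exprVn.
Qed.

Lemma geometric_increments_cvg (V : completeNormedModType R) (u : V^nat) C :
  (forall k, `|u k.+1 - u k| <= C / 2 ^+ k) -> cvgn u.
Proof.
move=> uC; rewrite (_ : u = fun n => u 0%N + series (telescope u) n); last first.
  by apply/funext => n; exact: eq_sum_telescope.
apply: (@is_cvgD _ _ _ _ _ (fun=> u 0%N)); first exact: is_cvg_cst.
apply/normed_cvg/(series_le_cvg (v_ := geometric C 2^-1)) => [n|n|n|] //=.
- by rewrite exprVn; exact: le_trans (normr_ge0 _) (uC n).
- by rewrite exprVn; exact: uC.
- by apply: is_cvg_geometric_series; rewrite ger0_norm//; lra.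
Qed.

Lemma geometric_increments_dist_lim (V : completeNormedModType R) (u : V^nat) C :
  (forall k, `|u k.+1 - u k| <= C / 2 ^+ k) ->
  forall k, `|u k - limn u| <= 2 * C / 2 ^+ k.
Proof.
move=> uC k.
have dist_le j : `|u k - u (j + k)%N| <= 2 * C / 2 ^+ k * (1 - 2^-1 ^+ j).
  elim: j => [|j IHj]; first by rewrite add0n subrr normr0 expr0 subrr mulr0.
  apply: le_trans (ler_distD (u (j + k)%N) _ _) _.
  apply: le_trans (lerD IHj _) _; first by rewrite distrC; exact: uC.
  by rewrite exprD exprS invfM exprVn; lra.
have C_ge0 : 0 <= C / 2 ^+ k by exact: le_trans (normr_ge0 _) (uC k).
have cvg_dist : `|u k - u (j + k)%N| @[j --> \oo] --> `|u k - limn u|.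
  apply: cvg_norm; apply: cvgB; first exact: cvg_cst.
  by rewrite (cvg_shiftn k u); exact: geometric_increments_cvg uC.
apply: cvgr_to_le cvg_dist _.
apply: nearW => j; apply: le_trans (dist_le j) _.
by rewrite ler_piMr ?gerBl ?exprn_ge0// -mulrA; lra.
Qed.

End sequences.

(** * Bounded measurable matrix functions *)

Section bounded_measurable.
Context {R : realType}.
Implicit Types (D : set R) (a b c : R).

Definition bounded_measurable p q D (F : R -> 'M[R]_(p, q)) :=
  (forall i j, measurable_fun D (fun x => F x i j)) /\
  exists M, forall x, D x -> `|F x| <= M.

Lemma bounded_measurable_cst p q D (F : 'M[R]_(p, q)) :
  bounded_measurable D (fun=> F).
Proof. by split; [move=> i j; exact: measurable_cst|exists `|F|]. Qed.

Lemma bounded_measurableD p q D (F G : R -> 'M[R]_(p, q)) :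
  bounded_measurable D F -> bounded_measurable D G ->
  bounded_measurable D (fun x => F x + G x).
Proof.
move=> [mF [M FM]] [mG [N GN]]; split => [i j|].
  under eq_fun do rewrite mxE.
  exact: measurable_funD.
by exists (M + N) => x Dx; apply: le_trans (ler_normD _ _) _; rewrite lerD ?FM ?GN.
Qed.

Lemma bounded_measurableM p q r D (F : R -> 'M[R]_(p, q)) (G : R -> 'M[R]_(q, r)) :
  bounded_measurable D F -> bounded_measurable D G ->
  bounded_measurable D (fun x => F x *m G x).
Proof.
move=> [mF [M FM]] [mG [N GN]]; split => [i j|].
  under eq_fun do rewrite mxE.
  by apply: measurable_sum => k; exact: measurable_funM.
exists (q%:R * M * N) => x Dx; apply: le_trans (norm_mulmx_le _ _) _.
by rewrite ler_pM ?mulr_ge0 ?GN// ler_wpM2l ?FM.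
Qed.

Lemma bounded_measurableZ p q D c (F : R -> 'M[R]_(p, q)) :
  bounded_measurable D F -> bounded_measurable D (fun x => c *: F x).
Proof.
move=> bF; under eq_fun do rewrite -mul_scalar_mx.
by apply: bounded_measurableM => //; exact: bounded_measurable_cst.
Qed.

Lemma bounded_measurableB p q D (F G : R -> 'M[R]_(p, q)) :
  bounded_measurable D F -> bounded_measurable D G ->
  bounded_measurable D (fun x => F x - G x).
Proof.
move=> bF bG; under eq_fun do rewrite -scaleN1r.
by apply: bounded_measurableD => //; exact: bounded_measurableZ.
Qed.

Lemma bounded_measurable_comp p q D D' (phi : R -> R) (F : R -> 'M[R]_(p, q)) :
  measurable D -> measurable_fun D' phi -> phi @` D' `<=` D ->
  bounded_measurable D F -> bounded_measurable D' (F \o phi).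
Proof.
move=> mD mphi phiD [mF [M FM]]; split => [i j|].
  exact: (measurable_comp mD phiD (mF i j)).
by exists M => x D'x; apply: FM; apply: phiD; exists x.
Qed.

Lemma bounded_measurableS p q D D' (F : R -> 'M[R]_(p, q)) :
  measurable D -> D' `<=` D -> bounded_measurable D F -> bounded_measurable D' F.
Proof.
by move=> mD D'D; apply: (bounded_measurable_comp (phi := id)); rewrite ?image_id.
Qed.

Lemma bounded_measurable_segmentS p q a b c d (F : R -> 'M[R]_(p, q)) :
  a <= c -> d <= b -> bounded_measurable `[a, b] F -> bounded_measurable `[c, d] F.
Proof. by move=> ac db; apply: bounded_measurableS => //; exact: subset_segment. Qed.

Lemma measurable_translation c : measurable_fun [set: R] (fun x : R => x - c).
Proof. by apply: measurable_funB => //; exact: measurable_cst. Qed.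

Lemma bounded_measurable_translation p q c (F : R -> 'M[R]_(p, q)) :
  bounded_measurable [set: R] F -> bounded_measurable [set: R] (fun x => F (x - c)).
Proof.
by apply: bounded_measurable_comp => //; exact: measurable_translation.
Qed.

Lemma bounded_measurable_clamp p q a b (F : R -> 'M[R]_(p, q)) : a <= b ->
  bounded_measurable `[a, b] F -> bounded_measurable [set: R] (F \o clamp a b).
Proof.
move=> ab; apply: bounded_measurable_comp => //.
  apply: measurable_maxr; first exact: measurable_cst.
  by apply: measurable_minr => //; exact: measurable_cst.
by move=> _ [x _ <-] /=; rewrite in_itv/=; exact: clamp_itv.
Qed.

Lemma bounded_measurable_if p q D (c : R -> bool) (F G : R -> 'M[R]_(p, q)) :
  measurable D -> measurable_fun D c ->
  bounded_measurable (D `&` c @^-1` [set true]) F ->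
  bounded_measurable (D `&` c @^-1` [set false]) G ->
  bounded_measurable D (fun x => if c x then F x else G x).
Proof.
move=> mD mc [mF [M FM]] [mG [N GN]]; split => [i j|].
  under eq_fun do rewrite (fun_if (fun P : 'M[R]_(p, q) => P i j)).
  exact: measurable_fun_if.
exists (Num.max M N) => x Dx; rewrite le_max.
by case: ifPn => [cx|/negbTE cx]; rewrite ?FM ?GN ?orbT.
Qed.

Lemma bounded_measurable_patch p q D (F0 : 'M[R]_(p, q)) F : measurable D ->
  bounded_measurable D F -> bounded_measurable [set: R] (patch (fun=> F0) D F).
Proof.
move=> mD bF; apply: bounded_measurable_if => //; last exact: bounded_measurable_cst.
  apply: (measurable_fun_bool true); rewrite setTI.
  by rewrite (_ : _ @^-1` _ = D)//; apply/seteqP; split => x /= => [/set_mem|/mem_set].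
by apply: bounded_measurableS bF => // x [_ /set_mem].
Qed.

Lemma bounded_measurable_col p D (v : R -> 'cV[R]_p) M :
  (forall i, measurable_fun D (fun x => v x i 0)) ->
  (forall x, D x -> `|v x| <= M) -> bounded_measurable D v.
Proof. by move=> mv vM; split; [move=> i j; rewrite ord1|exists M]. Qed.

Lemma measurable_norm_mx p q D (F : R -> 'M[R]_(p, q)) :
  bounded_measurable D F -> measurable_fun D (fun x => `|F x|).
Proof.
move=> [mF _]; under eq_fun do rewrite /Num.Def.normr/= mx_normrE.
elim: (index_enum _) => [|ij s IHs].
  by under eq_fun do rewrite big_nil; exact: measurable_cst.
under eq_fun do rewrite big_cons.
by apply: measurable_maxr => //; apply: measurableT_comp.
Qed.

Lemma within_continuous_bounded_measurable p q a b (F : R -> 'M[R]_(p, q)) :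
  {within `[a, b], continuous F} -> bounded_measurable `[a, b] F.
Proof.
move=> cF; split => [i j|].
  apply: subspace_continuous_measurable_fun => //.
  move: cF => /subspace_continuousP cF; apply/subspace_continuousP => x /cF.
  by move/(cvg_comp _ (fun M : 'M[R]_(p, q) => M i j)); apply; exact: coord_continuous.
have [M FM] := compact_norm_bounded (continuous_compact cF (@segment_compact _ a b)).
by exists M => x abx; apply: FM; exists x.
Qed.

Lemma bounded_measurable_norm_le p q D (F : R -> 'M[R]_(p, q)) :
  bounded_measurable D F -> exists2 M, 0 <= M & forall x, D x -> `|F x| <= M.
Proof.
move=> [_ [M FM]]; exists `|M| => // x Dx; exact: le_trans (FM x Dx) (ler_norm M).
Qed.

Lemma bounded_measurable_operator_bound p q D (F : R -> 'M[R]_(p, q)) :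
  bounded_measurable D F ->
  exists2 M, 0 < M & forall r (v : 'cV[R]_q), D r -> `|F r *m v| <= M * `|v|.
Proof.
move=> /bounded_measurable_norm_le[M M0 FM]; exists (q%:R * M + 1).
  by rewrite ltr_wpDl// mulr_ge0.
move=> r v Dr; apply: le_trans (norm_mulmx_le _ _) _; rewrite ler_wpM2r//.
by rewrite ler_wpDr// ler_wpM2l// FM.
Qed.

Lemma bounded_measurable_integrable p q a b (F : R -> 'M[R]_(p, q)) i j :
  bounded_measurable `[a, b] F ->
  (@lebesgue_measure R).-integrable `[a, b] (fun x => (F x i j)%:E).
Proof.
move=> [mF [M FM]]; apply: measurable_bounded_integrable => //.
- by rewrite /= lebesgue_measure_itv/=; case: ifPn; rewrite ?EFinN -?EFinB ltry.
- exact: mF.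
- exists M; split; first exact: num_real.
  move=> N MN x /FM FxM; apply: le_trans (norm_coord_le _ _ _) _.
  exact: le_trans FxM (ltW MN).
Qed.

End bounded_measurable.

(* Instance search does not see [R] as the carrier of the Lebesgue measure. *)
#[local] Instance lebesgue_ae_filter (R : realType) :
  Filter (nbhs (almost_everywhere (@lebesgue_measure R))) :=
  ae_filter_ringOfSetsType _.

Section mxRintegral.
Context {R : realType}.
Notation mu := (@lebesgue_measure R).
Implicit Types (a b c s : R).

Definition mxRintegral p q a b (F : R -> 'M[R]_(p, q)) : 'M[R]_(p, q) :=
  \matrix_(i, j) \int[mu]_(x in `[a, b]) F x i j.

Lemma eq_mxRintegral p q a b (F G : R -> 'M[R]_(p, q)) :
  (forall x, a <= x <= b -> F x = G x) -> mxRintegral a b F = mxRintegral a b G.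
Proof.
move=> FG; apply/matrixP => i j; rewrite !mxE; apply: eq_Rintegral => x.
by rewrite inE/= in_itv/= => /FG ->.
Qed.

Lemma ae_eq_mxRintegral p q a b (F G : R -> 'M[R]_(p, q)) :
  bounded_measurable `[a, b] F -> bounded_measurable `[a, b] G ->
  {ae mu, forall x, a <= x <= b -> F x = G x} ->
  mxRintegral a b F = mxRintegral a b G.
Proof.
move=> [mF _] [mG _] FG; apply/matrixP => i j; rewrite !mxE /Rintegral; congr fine.
apply: ae_eq_integral => //.
- by apply/measurable_EFinP; exact: mF.
- by apply/measurable_EFinP; exact: mG.
- by apply: filterS FG => x FGx /=; rewrite in_itv/= => /FGx ->.
Qed.

Lemma mxRintegralD p q a b (F G : R -> 'M[R]_(p, q)) :
  bounded_measurable `[a, b] F -> bounded_measurable `[a, b] G ->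
  mxRintegral a b (fun x => F x + G x) = mxRintegral a b F + mxRintegral a b G.
Proof.
move=> bF bG; apply/matrixP => i j; rewrite !mxE -RintegralD//; last 2 first.
- exact: bounded_measurable_integrable.
- exact: bounded_measurable_integrable.
by apply: eq_Rintegral => x _; rewrite mxE.
Qed.

Lemma mxRintegral_mulmxr p q r a b (F : R -> 'M[R]_(p, q)) (P : 'M[R]_(q, r)) :
  bounded_measurable `[a, b] F ->
  mxRintegral a b (fun x => F x *m P) = mxRintegral a b F *m P.
Proof.
move=> bF; apply/matrixP => i j; rewrite !mxE.
have int_k k : mu.-integrable `[a, b] (fun x => (F x i k * P k j)%:E).
  exact: (integrableZr _ _ (bounded_measurable_integrable i k bF)).
transitivity (fine (\sum_k \int[mu]_(x in `[a, b]) (F x i k * P k j)%:E)%E).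
  rewrite /Rintegral -integral_sum//; congr fine; apply: eq_integral => x _.
  by rewrite mxE -sumEFin.
rewrite -sum_fine => [|k _]; last exact: integrable_fin_num.
apply: eq_bigr => k _; rewrite mxE -RintegralZr//.
exact: bounded_measurable_integrable.
Qed.

Lemma mxRintegralZ p q a b c (F : R -> 'M[R]_(p, q)) :
  bounded_measurable `[a, b] F ->
  mxRintegral a b (fun x => c *: F x) = c *: mxRintegral a b F.
Proof.
move=> bF; apply/matrixP => i j; rewrite !mxE -RintegralZl//; last first.
  exact: bounded_measurable_integrable.
by apply: eq_Rintegral => x _; rewrite mxE.
Qed.

Lemma mxRintegralB p q a b (F G : R -> 'M[R]_(p, q)) :
  bounded_measurable `[a, b] F -> bounded_measurable `[a, b] G ->
  mxRintegral a b (fun x => F x - G x) = mxRintegral a b F - mxRintegral a b G.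
Proof.
move=> bF bG; rewrite -[in RHS]scaleN1r -mxRintegralZ// -mxRintegralD//.
  by apply: eq_mxRintegral => x _; rewrite scaleN1r.
exact: bounded_measurableZ.
Qed.

Lemma mxRintegral_point p q a (F : R -> 'M[R]_(p, q)) : mxRintegral a a F = 0.
Proof. by apply/matrixP => i j; rewrite !mxE set_itv1 Rintegral_set1. Qed.

Lemma mxRintegral_cat p q a b c (F : R -> 'M[R]_(p, q)) : a <= b -> b <= c ->
  bounded_measurable `[a, c] F ->
  mxRintegral a c F = mxRintegral a b F + mxRintegral b c F.
Proof.
move=> ab bc bF; apply/matrixP => i j; rewrite !mxE.
have iF := bounded_measurable_integrable i j bF.
rewrite -(@Rintegral_itv_obnd_cbnd _ b); last first.
  by apply: integrableS iF => //; apply: subset_itvr; rewrite bnd_simp.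
by rewrite -(Rintegral_itvB iF) ?bnd_simp// addrC subrK.
Qed.

Lemma norm_mxRintegral_le_Rintegral p q a b (F : R -> 'M[R]_(p, q)) (g : R -> R) :
  bounded_measurable `[a, b] F -> mu.-integrable `[a, b] (EFin \o g) ->
  (forall x, a <= x <= b -> `|F x| <= g x) ->
  `|mxRintegral a b F| <= \int[mu]_(x in `[a, b]) g x.
Proof.
move=> bF ig Fg; apply: mx_norm_le => [|i j].
  by apply: Rintegral_ge0 => x; rewrite /= in_itv/= => /Fg; exact: le_trans.
have iF := bounded_measurable_integrable i j bF.
rewrite mxE; apply: le_trans (le_normr_Rintegral _ iF) _ => //.
apply: le_Rintegral => //; first exact: integrable_norm iF.
by move=> x; rewrite /= in_itv/= => /Fg; apply: le_trans; exact: norm_coord_le.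
Qed.

Lemma norm_mxRintegral_le p q a b (F : R -> 'M[R]_(p, q)) M : a <= b ->
  bounded_measurable `[a, b] F -> (forall x, a <= x <= b -> `|F x| <= M) ->
  `|mxRintegral a b F| <= M * (b - a).
Proof.
move=> ab bF FM.
have -> : M * (b - a) = \int[mu]_(x in `[a, b]) M.
  rewrite Rintegral_cst//= lebesgue_measure_itv/= lte_fin.
  by case: ltgtP ab => // ->; rewrite subrr.
apply: norm_mxRintegral_le_Rintegral => //.
apply: continuous_compact_integrable; first exact: segment_compact.
by apply: continuous_subspaceT => x; exact: cvg_cst.
Qed.

Lemma lebesgue_measure_translation c (A : set R) : measurable A ->
  pushforward mu (fun x => x - c : measurableTypeR R) A = mu A.
Proof.
move=> mA; apply/esym/lebesgue_measure_unique => //=.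
  exact: measurable_translation.
move=> mT _ [[x y] /= _ <-]; rewrite /pushforward.
rewrite (_ : _ @^-1` _ = `]x + c, y + c]%classic); last first.
  by apply/seteqP; split => z /=; rewrite !in_itv/=; lra.
rewrite !lebesgue_measure_itv/= !lte_fin ltrD2r -!EFinD.
by rewrite (_ : y + c - _ = y - x)//; ring.
Qed.

Lemma ae_translation c (P : R -> Prop) : {ae mu, forall x, P x} ->
  {ae mu, forall x, P (x - c)}.
Proof.
move=> [A [mA A0 PA]]; exists ((fun x => x - c) @^-1` A); split => [||x nPx].
- by rewrite -[X in measurable X]setTI; exact: measurable_translation.
- by rewrite -[RHS]A0 -(lebesgue_measure_translation c mA).
- exact: PA.
Qed.

Lemma mxRintegral_translation p q a b c (F : R -> 'M[R]_(p, q)) :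
  bounded_measurable [set: R] F ->
  mxRintegral a b (fun x => F (x - c)) = mxRintegral (a - c) (b - c) F.
Proof.
move=> bF; apply/matrixP => i j; rewrite !mxE /Rintegral; congr fine.
have mtr := measurable_translation c.
have segE : (fun x => x - c) @^-1` `[a - c, b - c] = `[a, b]%classic.
  by apply/seteqP; split => x /=; rewrite !in_itv/=; lra.
have := @integral_pushforward _ _ (measurableTypeR R) (measurableTypeR R) R
  (fun x => x - c) mtr mu `[a - c, b - c]%classic
  (fun x => (F x i j)%:E).
rewrite segE => <- //.
- by apply: eq_measure_integral => A mA _; exact: lebesgue_measure_translation.
- by apply/measurable_EFinP; exact: bF.1.
- apply: (@bounded_measurable_integrable _ _ _ _ _ (fun x => F (x - c))).
  exact: bounded_measurableS (bounded_measurable_translation c bF).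
Qed.

Lemma norm_mxRintegral_translation_le p q a b h M (F : R -> 'M[R]_(p, q)) :
  a <= b -> 0 <= h -> bounded_measurable [set: R] F -> (forall x, `|F x| <= M) ->
  `|mxRintegral a b (fun x => F (x - h)) - mxRintegral a b F| <= 2 * M * h.
Proof.
move=> ab h0 bF FM; rewrite mxRintegral_translation//.
have bF' x y : bounded_measurable `[x, y] F by exact: bounded_measurableS bF.
have -> : mxRintegral (a - h) (b - h) F - mxRintegral a b F =
    mxRintegral (a - h) a F - mxRintegral (b - h) b F.
  apply/eqP; rewrite subr_eq addrAC -subr_eq opprK -!mxRintegral_cat//; lra.
apply: le_trans (ler_normB _ _) _.
have bound x : `|mxRintegral (x - h) x F| <= M * h.
  by rewrite -[X in M * X](subKr x); apply: norm_mxRintegral_le => //; lra.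
by have := bound a; have := bound b; lra.
Qed.

End mxRintegral.

(** * Linear integral equations *)

Section linear_equations.
Context {R : realType}.
Notation mu := (@lebesgue_measure R).
Implicit Types (a b c r s : R).

Lemma dist_mxRintegral_le p q a b x y M (F : R -> 'M[R]_(p, q)) :
  bounded_measurable `[a, b] F -> (forall r, a <= r <= b -> `|F r| <= M) ->
  a <= x <= b -> a <= y <= b ->
  `|mxRintegral a x F - mxRintegral a y F| <= M * `|x - y|.
Proof.
move=> bF FM; wlog xy : x y / y <= x => [WH xab yab|xab yab].
  have [yx|/ltW xy] := leP y x; first exact: WH.
  by rewrite distrC (distrC x); exact: WH.
rewrite (@mxRintegral_cat _ _ _ a y x) ?xy//; [|lra|]; last first.
  by apply: bounded_measurable_segmentS bF => //; lra.
rewrite addrC addKr (ger0_norm (_ : 0 <= x - y)) ?subr_ge0//.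
apply: norm_mxRintegral_le => // [|r ryx]; last by apply: FM; lra.
by apply: bounded_measurable_segmentS bF; lra.
Qed.

Lemma mxRintegral_within_continuous p q a b (F : R -> 'M[R]_(p, q)) :
  bounded_measurable `[a, b] F ->
  {within `[a, b], continuous (fun s => mxRintegral a s F)}.
Proof.
move=> bF; have [M _ FM] := bounded_measurable_norm_le bF.
apply: (lipschitz_within_continuous (L := M)) => x y /=; rewrite !in_itv/=.
by apply: dist_mxRintegral_le bF _ => r rab; apply: FM; rewrite /= in_itv.
Qed.

Lemma continuous_expR_affine c a : continuous (fun r => expR (c * (r - a))).
Proof.
move=> r; apply: (@continuous_comp _ _ _ (fun r => c * (r - a)) expR).
  by apply: cvgM; [exact: cvg_cst|apply: cvgB; [exact: cvg_id|exact: cvg_cst]].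
exact: continuous_expR.
Qed.

Lemma Rintegral_expR c a s : 0 < c -> a <= s ->
  \int[mu]_(r in `[a, s]) expR (c * (r - a)) = (expR (c * (s - a)) - 1) / c.
Proof.
move=> c0; rewrite le_eqVlt => /predU1P[->|a_s].
  by rewrite set_itv1 Rintegral_set1 subrr mulr0 expR0 subrr mul0r.
pose F r := c^-1 * expR (c * (r - a)).
have dF r : is_derive r (1 : R) F (expR (c * (r - a))).
  apply: is_derive_eq; rewrite /GRing.scale/= subr0 mulr1 mulrCA.
  by rewrite mulVf ?gt_eqF// mulr1.
have cF : continuous F.
  by move=> r; apply: differentiable_continuous; apply/derivable1_diffP; case: (dF r).
rewrite /Rintegral (@continuous_FTC2 _ _ F a s a_s); first last.
- by move=> r _; rewrite derive1E; case: (dF r).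
- split.
  + by move=> r _; case: (dF r).
  + by apply: cvg_at_right_filter; exact: cF.
  + by apply: cvg_at_left_filter; exact: cF.
- by apply: continuous_subspaceT; exact: continuous_expR_affine.
by rewrite -EFinB /= /F subrr mulr0 expR0; ring.
Qed.

Variables (n : nat) (a b : R) (A : R -> 'M[R]_n).
Hypothesis bA : bounded_measurable `[a, b] A.

Definition picard (x : 'cV[R]_n) (f xi : R -> 'cV[R]_n) s :=
  x + mxRintegral a s (fun r => A r *m xi r + f r).

Definition linear_solution x f xi := bounded_measurable `[a, b] xi /\
  forall s, a <= s <= b -> xi s = picard x f xi s.

Lemma linear_rhs_bounded_measurable f xi s : s <= b ->
  bounded_measurable `[a, b] xi -> bounded_measurable `[a, b] f ->
  bounded_measurable `[a, s] (fun r => A r *m xi r + f r : 'cV[R]_n).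
Proof.
move=> sb bxi bf; apply: (bounded_measurable_segmentS (lexx a) sb).
by apply: bounded_measurableD => //; exact: bounded_measurableM.
Qed.

Lemma picard_continuous x f xi :
  bounded_measurable `[a, b] f -> bounded_measurable `[a, b] xi ->
  {within `[a, b], continuous (picard x f xi)}.
Proof.
move=> bf bxi s; apply: cvgD; first exact: cvg_cst.
by apply: mxRintegral_within_continuous; exact: linear_rhs_bounded_measurable.
Qed.

Lemma linear_solution_continuous x f xi : bounded_measurable `[a, b] f ->
  linear_solution x f xi -> {within `[a, b], continuous xi}.
Proof.
move=> bf [bxi xiE].
apply: (subspace_eq_continuous _ (picard_continuous (x := x) bf bxi)) => s.
by rewrite inE/= in_itv/= => /xiE.
Qed.

Lemma linear_solutionZ c x f xi : bounded_measurable `[a, b] f ->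
  linear_solution x f xi ->
  linear_solution (c *: x) (fun r => c *: f r) (fun r => c *: xi r).
Proof.
move=> bf [bxi xiE]; split=> [|s sab]; first exact: bounded_measurableZ.
have [_ sb] := andP sab.
rewrite xiE// /picard scalerDr -mxRintegralZ; last exact: linear_rhs_bounded_measurable.
by congr (_ + _); apply: eq_mxRintegral => r _; rewrite scalerDr -scalemxAr.
Qed.

Lemma linear_solutionD x x' f f' xi xi' :
  bounded_measurable `[a, b] f -> bounded_measurable `[a, b] f' ->
  linear_solution x f xi -> linear_solution x' f' xi' ->
  linear_solution (x + x') (fun r => f r + f' r) (fun r => xi r + xi' r).
Proof.
move=> bf bf' [bxi xiE] [bxi' xiE']; split=> [|s sab].
  exact: bounded_measurableD.
have [_ sb] := andP sab.
rewrite xiE// xiE'// /picard addrACA -mxRintegralD; first last.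
- exact: linear_rhs_bounded_measurable.
- exact: linear_rhs_bounded_measurable.
by congr (_ + _); apply: eq_mxRintegral => r _; rewrite mulmxDr addrACA.
Qed.

Section weighted_norm.
Variable M : R.
Hypotheses (M0 : 0 < M) (AM : forall r (v : 'cV[R]_n), a <= r <= b ->
  `|A r *m v| <= M * `|v|).

(* Integrating [A r *m y r] halves the sup norm of [y] relative to this weight; both
   Gronwall's lemma and the contraction property of [picard] rest on it. *)
Let weight r := expR (2 * M * (r - a)).

Let weight_ge1 r : a <= r -> 1 <= weight r.
Proof. by move=> ar; rewrite -expR0 ler_expR mulr_ge0 ?subr_ge0// mulr_ge0// ltW. Qed.

Let weight_le r s : r <= s -> weight r <= weight s.
Proof. by move=> rs; rewrite ler_expR ler_pM2l ?mulr_gt0// lerD2r. Qed.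

Lemma weighted_mxRintegral_half (K : R) (y : R -> 'cV[R]_n) :
  0 <= K -> bounded_measurable `[a, b] y ->
  (forall r, a <= r <= b -> `|y r| <= K * weight r) ->
  forall s, a <= s <= b ->
    `|mxRintegral a s (fun r => A r *m y r)| <= K / 2 * weight s.
Proof.
move=> K0 by' yK s sab; have [a_s sb] := andP sab.
have int_weight : mu.-integrable `[a, s] (EFin \o weight).
  apply: continuous_compact_integrable; first exact: segment_compact.
  by apply: continuous_subspaceT; exact: continuous_expR_affine.
apply: (@le_trans _ _ (\int[mu]_(r in `[a, s]) (M * K * weight r))).
  apply: norm_mxRintegral_le_Rintegral.
  - by apply: (bounded_measurable_segmentS (lexx a) sb); exact: bounded_measurableM.
  - exact: (integrableZl _ _ int_weight).
  - move=> r ras; have rab : a <= r <= b by lra.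
    by apply: le_trans (AM _ rab) _; rewrite -mulrA ler_pM2l// yK.
rewrite RintegralZl// Rintegral_expR ?mulr_gt0// -/(weight s).
rewrite (_ : M * K * _ = K / 2 * (weight s - 1)); last by field; rewrite gt_eqF.
by rewrite ler_wpM2l ?divr_ge0// gerBl.
Qed.

Lemma gronwall_weighted e (p q : R -> 'cV[R]_n) :
  0 <= e -> bounded_measurable `[a, b] p ->
  (forall s, a <= s <= b -> `|q s| <= e) ->
  (forall s, a <= s <= b -> p s = q s + mxRintegral a s (fun r => A r *m p r)) ->
  forall s, a <= s <= b -> `|p s| <= 2 * e * weight s.
Proof.
move=> e0 bp qe pE s sab.
pose ratios := [set `|p r| / weight r | r in `[a, b]]; pose K := sup ratios.
have [C C0 pC] := bounded_measurable_norm_le bp.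
have ratios_ub : has_ubound ratios.
  exists C => _ [r rab <-]; have /andP[ar _] : a <= r <= b := rab.
  rewrite ler_pdivrMr ?expR_gt0//; apply: le_trans (pC r rab) _.
  by rewrite ler_peMr// weight_ge1.
have p_le r : a <= r <= b -> `|p r| <= K * weight r.
  move=> rab; rewrite -ler_pdivrMr ?expR_gt0//; apply: ub_le_sup => //.
  by exists r => //; rewrite /= in_itv.
have K0 : 0 <= K.
  by have := le_trans (normr_ge0 _) (p_le s sab); rewrite pmulr_lge0 ?expR_gt0.
have K_le : K <= e + K / 2.
  apply: ge_sup; first by exists (`|p s| / weight s), s => //; rewrite /= in_itv.
  move=> _ [r rab <-]; have /andP[ar rb] : a <= r <= b := rab.
  rewrite ler_pdivrMr ?expR_gt0// pE ?ar// mulrDl.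
  apply: le_trans (ler_normD _ _) _; apply: lerD; last first.
    by apply: weighted_mxRintegral_half; rewrite ?ar.
  by apply: le_trans (qe r rab) _; rewrite ler_peMr// weight_ge1.
by apply: le_trans (p_le s sab) _; rewrite ler_wpM2r ?expR_ge0//; lra.
Qed.

Variables (x : 'cV[R]_n) (f : R -> 'cV[R]_n).
Hypothesis bf : bounded_measurable `[a, b] f.

Lemma picard_bounded_measurable xi : bounded_measurable `[a, b] xi ->
  bounded_measurable `[a, b] (picard x f xi).
Proof.
by move=> bxi; apply: within_continuous_bounded_measurable; exact: picard_continuous.
Qed.

Lemma picard_contraction K xi xi' : 0 <= K ->
  bounded_measurable `[a, b] xi -> bounded_measurable `[a, b] xi' ->
  (forall r, a <= r <= b -> `|xi r - xi' r| <= K * weight r) ->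
  forall s, a <= s <= b -> `|picard x f xi s - picard x f xi' s| <= K / 2 * weight s.
Proof.
move=> K0 bxi bxi' dist_xi s sab.
have [_ sb] := andP sab.
rewrite /picard opprD addrACA subrr add0r -mxRintegralB; first last.
- exact: linear_rhs_bounded_measurable.
- exact: linear_rhs_bounded_measurable.
under eq_mxRintegral => r _ do rewrite opprD addrACA subrr addr0 -mulmxBr.
by apply: weighted_mxRintegral_half => //; exact: bounded_measurableB.
Qed.

Let iterate k := iter k (picard x f) (fun=> 0).

Let iterate_bounded_measurable k : bounded_measurable `[a, b] (iterate k).
Proof.
elim: k => [|k IHk]; first exact: bounded_measurable_cst.
exact: picard_bounded_measurable.
Qed.

Let iterate_increments : exists2 C, 0 <= C & forall s, a <= s <= b ->
  forall k, `|iterate k.+1 s - iterate k s| <= C * weight s / 2 ^+ k.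
Proof.
have [C C0 iterate1C] := bounded_measurable_norm_le (iterate_bounded_measurable 1).
exists C => // + + k; elim: k => [|k IHk] s sab.
  rewrite subr0 expr0 divr1; apply: le_trans (iterate1C s sab) _.
  by rewrite ler_peMr// weight_ge1//; have [] := andP sab.
rewrite (_ : C * _ / _ = C / 2 ^+ k / 2 * weight s); last by rewrite exprSr invfM; ring.
apply: picard_contraction => //.
- by rewrite divr_ge0 ?exprn_ge0.
- exact: (iterate_bounded_measurable k.+1).
- by move=> r rab; rewrite mulrAC; exact: IHk.
Qed.

Let xi_ s := limn (fun k => iterate k s).

Let iterate_cvg s : a <= s <= b -> iterate k s @[k --> \oo] --> xi_ s.
Proof.
have [C _ incr] := iterate_increments.
by move=> /incr/geometric_increments_cvg.
Qed.

Let iterate_dist_lim : exists2 C, 0 <= C & forall k s, a <= s <= b ->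
  `|iterate k s - xi_ s| <= C / 2 ^+ k * weight s.
Proof.
have [C C0 incr] := iterate_increments; exists (2 * C) => [|k s sab].
  by rewrite mulr_ge0.
by rewrite mulrAC -[2 * C * _]mulrA; exact: geometric_increments_dist_lim (incr s sab) k.
Qed.

Let lim_bounded_measurable : bounded_measurable `[a, b] xi_.
Proof.
have [C C0 dist_xi] := iterate_dist_lim.
apply: (@bounded_measurable_col _ _ _ _ (C * weight b)) => [i|s].
  apply: (@measurable_fun_cvg _ _ _ _ (fun k s => iterate k s i 0)) => [k|s sab].
    exact: (iterate_bounded_measurable k).1.
  apply: (cvg_comp _ (fun v : 'cV[R]_n => v i 0) (iterate_cvg sab)).
  exact: coord_continuous.
rewrite /= in_itv/= => sab; have := dist_xi 0 s sab.
rewrite expr0 divr1 sub0r normrN => /le_trans; apply.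
by rewrite ler_wpM2l// weight_le//; have [] := andP sab.
Qed.

Lemma picard_fixpoint : exists xi, linear_solution x f xi.
Proof.
have [C C0 dist_xi] := iterate_dist_lim.
exists xi_; split=> [|s sab]; first exact: lim_bounded_measurable.
apply/eqP; rewrite -subr_eq0 -normr_le0.
apply: (@le_geometric_le0 _ _ (C * weight s)) => k.
have wC : 0 <= C / 2 ^+ k by rewrite divr_ge0 ?exprn_ge0.
apply: le_trans (ler_distD (iterate k.+1 s) _ _) _; rewrite distrC.
apply: le_trans (lerD (dist_xi k.+1 s sab) (_ : _ <= C / 2 ^+ k / 2 * weight s)) _.
  by apply: picard_contraction => // r; exact: dist_xi.
by rewrite exprSr invfM; lra.
Qed.

End weighted_norm.

Lemma linear_solution_exists x f : bounded_measurable `[a, b] f ->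
  exists xi, linear_solution x f xi.
Proof.
move=> bf; have [M M0 AM] := bounded_measurable_operator_bound bA.
apply: (picard_fixpoint M0 _ _ bf) => r v rab; apply: AM.
by rewrite /= in_itv.
Qed.

Lemma linear_solution_stable : exists2 C, 0 < C & forall e x f f' xi xi', 0 <= e ->
  bounded_measurable `[a, b] f -> bounded_measurable `[a, b] f' ->
  linear_solution x f xi -> linear_solution x f' xi' ->
  (forall s, a <= s <= b -> `|mxRintegral a s (fun r => f r - f' r)| <= e) ->
  forall s, a <= s <= b -> `|xi s - xi' s| <= C * e.
Proof.
have [M M0 AM] := bounded_measurable_operator_bound bA.
have {}AM r (v : 'cV[R]_n) : a <= r <= b -> `|A r *m v| <= M * `|v|.
  by move=> rab; apply: AM; rewrite /= in_itv.
exists (2 * expR (2 * M * (b - a))) => [|e x f f' xi xi' e0 bf bf' sol sol' ff' s sab].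
  by rewrite mulr_gt0 ?expR_gt0.
have [[bxi xiE] [bxi' xiE']] := (sol, sol').
have bdiff := bounded_measurableB bxi bxi'.
apply: le_trans (gronwall_weighted M0 AM e0 bdiff ff' _ sab) _ => [r rab|]; last first.
  rewrite mulrAC ler_wpM2r// ler_pM2l// ler_expR ler_pM2l ?mulr_gt0//.
  by have := andP sab; lra.
have [_ rb] := andP rab.
have brhs := linear_rhs_bounded_measurable rb bxi bf.
have brhs' := linear_rhs_bounded_measurable rb bxi' bf'.
rewrite xiE// xiE'// /picard opprD addrACA subrr add0r -mxRintegralB//.
rewrite -mxRintegralD; first last.
- by apply: (bounded_measurable_segmentS (lexx a) rb); exact: bounded_measurableM.
- by apply: (bounded_measurable_segmentS (lexx a) rb); exact: bounded_measurableB.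
apply: eq_mxRintegral => z _.
by rewrite mulmxBr opprD addrACA addrC.
Qed.

End linear_equations.

(** * Delayed responses to a strategy *)

Section approximate_selection.
Context {R : realType}.
Implicit Types (e : R) (D : set R).

Definition net_preimage n m (u0 : 'cV[R]_m) (s : seq 'cV[R]_m) e
    (B : 'M[R]_(n, m)) (w : 'cV[R]_n) : 'cV[R]_m :=
  nth u0 s (find (fun v => `|B *m v - w| <= e) s).

Lemma net_preimage_bounded_measurable n m u0 s e D (B : R -> 'M[R]_(n, m))
    (w : R -> 'cV[R]_n) : measurable D ->
  bounded_measurable D B -> bounded_measurable D w ->
  bounded_measurable D (fun r => net_preimage u0 s e (B r) (w r)).
Proof.
move=> mD bB bw; elim: s => [|v s IHs]; first exact: bounded_measurable_cst.
rewrite (_ : (fun r => _) = fun r => if `|B r *m v - w r| <= e then v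
  else net_preimage u0 s e (B r) (w r)); last first.
  by apply/funext => r; rewrite /net_preimage /=; case: ifP.
apply: bounded_measurable_if => //; [|exact: bounded_measurable_cst|]; last first.
  by apply: bounded_measurableS IHs => //; exact: subIsetl.
apply: measurable_fun_ler; last exact: measurable_cst.
apply: measurable_norm_mx; apply: bounded_measurableB => //.
by apply: bounded_measurableM => //; exact: bounded_measurable_cst.
Qed.

Lemma approximate_selection n m D (B : R -> 'M[R]_(n, m)) (U : set 'cV[R]_m) e :
  measurable D -> bounded_measurable D B -> compact U -> U !=set0 -> 0 < e ->
  exists S : R -> 'cV[R]_n -> 'cV[R]_m, [/\ forall r w, U (S r w),
    forall w, bounded_measurable D w -> bounded_measurable D (fun r => S r (w r)) &
    forall r w, D r -> mimage (B r) U w -> `|B r *m S r w - w| <= e].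
Proof.
move=> mD bB cU [u0 Uu0] e0.
have [C C0 BC] := bounded_measurable_operator_bound bB.
have [s sU sP] := compact_finite_net cU (divr_gt0 e0 C0).
exists (fun r => net_preimage u0 s e (B r)); split => [r w|w bw|r w Dr [u Uu <-]].
- rewrite /net_preimage; set k := find _ s.
  have [ks|sk] := ltnP k (size s); first by apply: sU; exact: mem_nth.
  by rewrite nth_default.
- exact: net_preimage_bounded_measurable.
- apply: (nth_find u0 (a := fun v => `|B r *m v - B r *m u| <= e)); apply/hasP.
  have [v vs vu] := sP u Uu; exists v => //.
  by rewrite -mulmxBr; apply: le_trans (BC _ _ Dr) _; rewrite mulrC -ler_pdivlMr.
Qed.

End approximate_selection.

Section delay.
Context {R : realType}.
Notation mu := (@lebesgue_measure R).
Implicit Types (a b h r s t T e : R).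

Lemma iter_delay_agree (X : Type) (P : (R -> X) -> Prop) (F : (R -> X) -> R -> X)
    u0 a b h :
  a <= b -> 0 < h -> P u0 -> (forall u, P u -> P (F u)) ->
  (forall s, a <= s <= b -> forall u v, P u -> P v ->
    {ae mu, forall r, a <= r <= s -> u r = v r} ->
    {ae mu, forall r, a <= r <= b -> r <= s + h -> F u r = F v r}) ->
  exists k, {ae mu, forall r, a <= r <= b -> iter k.+1 F u0 r = iter k F u0 r}.
Proof.
move=> ab h0 Pu0 PF F_delay.
have Piter k : P (iter k F u0) by elim: k => //= k; exact: PF.
(* Each iteration settles the function on one more interval of length [h]. *)
have agree k : {ae mu, forall r, a <= r <= b -> r <= a + k%:R * h ->
    iter k.+1 F u0 r = iter k F u0 r}.
  elim: k => [|k IHk].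
    exists [set a]; split=> //; first exact: lebesgue_measure_set1.
    move=> r /= not_agree; apply: contrapT => neq_ra; apply: not_agree => /andP[ar _].
    by rewrite mul0r addr0 => ra; case: neq_ra; apply: le_anti; rewrite ra.
  have kh0 : 0 <= k%:R * h by rewrite mulr_ge0// ltW.
  have [kb|bk] := leP (a + k%:R * h) b.
    have {}kb : a <= a + k%:R * h <= b by rewrite kb lerDl kh0.
    apply: filterS (F_delay _ kb _ _ (Piter k.+1) (Piter k) _) => [r agree_r rab rk|].
      by apply: agree_r => //; move: rk; rewrite -natr1 mulrDl mul1r addrA.
    by apply: filterS IHk => r agree_r rk; apply: agree_r; lra.
  have bb : a <= b <= b by rewrite ab lexx.
  apply: filterS (F_delay _ bb _ _ (Piter k.+1) (Piter k) _) => [r agree_r rab _|].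
    by apply: agree_r => //; lra.
  by apply: filterS IHk => r agree_r rk; apply: agree_r; lra.
exists (Num.bound ((b - a) / h)); apply: filterS (agree _) => r agree_r rab.
apply: agree_r => //; rewrite -lerBlDl; apply: le_trans (_ : b - a <= _); first lra.
by rewrite -ler_pdivrMr// ltW// archi_boundP// divr_ge0 ?subr_ge0// ltW.
Qed.

Definition response m l t T (u0 : 'cV[R]_m) (S : R -> 'cV[R]_l -> 'cV[R]_m)
    (delta : (R -> 'cV[R]_m) -> R -> 'cV[R]_l) u : R -> 'cV[R]_m :=
  patch (fun=> u0) `[t, T] (fun r => S r (delta u r)).

Lemma delayed_response_exists m l t T h (U : set 'cV[R]_m) (D : set 'cV[R]_l)
    delta (S : R -> 'cV[R]_l -> 'cV[R]_m) u0 :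
  t <= T -> 0 < h -> nonanticipative t T U D delta -> U u0 ->
  (forall r d, U (S r d)) ->
  (forall d, admissible t T (fun=> D) d ->
    bounded_measurable `[t, T] (fun r => S r (d r))) ->
  exists2 u, admissible t T (fun=> U) u &
    {ae mu, forall s, t <= s <= T -> u s = response t T u0 S delta u (s - h)}.
Proof.
move=> tT h0 [deltaD delta_na] Uu0 SU bS.
pose F u s := response t T u0 S delta u (s - h).
have adm_u0 : admissible t T (fun=> U) (fun=> u0).
  by split=> // i; exact: measurable_cst.
have adm_F u : admissible t T (fun=> U) u -> admissible t T (fun=> U) (F u).
  move=> adm_u; split=> [i|s _]; last by rewrite /F /response /patch; case: ifP.
  have bresp : bounded_measurable [set: R] (response t T u0 S delta u).
    by apply: bounded_measurable_patch => //; apply: bS; exact: deltaD.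
  exact: measurable_funTS ((bounded_measurable_translation h bresp).1 i 0).
have [s stT u v adm_u adm_v uv|k agree] := iter_delay_agree tT h0 adm_u0 adm_F.
  apply: filterS (ae_translation h (delta_na s stT u v adm_u adm_v uv)) => r delta_r.
  move=> rtT rs; rewrite /F /response /patch; case: ifP => // /set_mem/=.
  by rewrite in_itv/= => rhtT; rewrite delta_r//; lra.
exists (iter k F (fun=> u0)); first by elim: k {agree} => //= k; exact: adm_F.
by apply: filterS agree => s agree_s /agree_s.
Qed.

Lemma norm_mxRintegral_delay_le n m a b h C K rho (F : R -> 'M[R]_(n, m))
    (v : R -> 'cV[R]_m) : a <= b -> 0 <= h ->
  bounded_measurable [set: R] F -> bounded_measurable [set: R] v ->
  (forall r, `|F r| <= C) -> (forall r, `|v r| <= K) ->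
  (forall r, `|F r - F (r - h)| <= rho) ->
  `|mxRintegral a b (fun r => F r *m v (r - h) - F r *m v r)| <=
    m%:R * rho * K * (b - a) + 2 * (m%:R * C * K) * h.
Proof.
move=> ab h0 bF bv FC vK Fo.
have bFv := bounded_measurableM bF bv.
have bS p q (G : R -> 'M[R]_(p, q)) : bounded_measurable [set: R] G ->
  bounded_measurable `[a, b] G by exact: bounded_measurableS.
have norm_mul_le (G : 'M[R]_(n, m)) (y : 'cV[R]_m) c :
    `|G| <= c -> `|y| <= K -> `|G *m y| <= m%:R * c * K.
  move=> Gc yK; apply: le_trans (norm_mulmx_le _ _) _.
  by rewrite ler_pM ?mulr_ge0// ler_wpM2l.
have bdF := bounded_measurableB bF (bounded_measurable_translation h bF).
have bvh := bounded_measurable_translation h bv.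
have bFvh := bounded_measurable_translation h bFv.
rewrite (@eq_mxRintegral _ _ _ _ _ _ (fun r => (F r - F (r - h)) *m v (r - h) +
  (F (r - h) *m v (r - h) - F r *m v r))); last first.
  by move=> r _; rewrite mulmxBl addrA subrK.
rewrite mxRintegralD; first last.
- by apply: bS; exact: bounded_measurableB.
- by apply: bS; exact: bounded_measurableM.
apply: le_trans (ler_normD _ _) _; apply: lerD.
  apply: norm_mxRintegral_le => //; first by apply: bS; exact: bounded_measurableM.
  by move=> r _; exact: norm_mul_le.
rewrite mxRintegralB; [|exact: bS|exact: bS].
apply: (norm_mxRintegral_translation_le (F := fun r => F r *m v r)) => // r.
exact: norm_mul_le.
Qed.

Lemma delay_effect_small n m a b K e (B : R -> 'M[R]_(n, m)) :
  {within `[a, b], continuous B} -> a <= b -> 0 < e ->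
  exists2 h, 0 < h & forall v : R -> 'cV[R]_m,
    bounded_measurable [set: R] v -> (forall r, `|v r| <= K) ->
    forall s, a <= s <= b ->
      `|mxRintegral a s (fun r => B r *m v (r - h) - B r *m v r)| <= e.
Proof.
move=> cB ab e0; have bB := within_continuous_bounded_measurable cB.
have [C C0 BC] := bounded_measurable_norm_le bB.
have e20 : 0 < e / 2 by rewrite divr_gt0.
have [rho rho0 rho_le] := exists_mul_le (m%:R * K * (b - a)) e20.
have [d d0 Bd] := compact_unif_continuous (@segment_compact _ a b) cB rho0.
have [h' h'0 h'_le] := exists_mul_le (2 * (m%:R * C * K)) e20.
pose h := Num.min (d / 2) h'.
have h0 : 0 < h by rewrite lt_min h'0 divr_gt0.
have hd : h < d by rewrite gt_min; apply/orP; left; lra.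
exists h => // v bv vK s sab; have [a_s sb] := andP sab.
(* Extending [B] by its values at the endpoints spares a case analysis near [a]. *)
have clampab r : `[a, b]%classic (clamp a b r) by rewrite /= in_itv/= clamp_itv.
rewrite (@eq_mxRintegral _ _ _ _ _ _ (fun r => (B \o clamp a b) r *m v (r - h) -
  (B \o clamp a b) r *m v r)) => [|r ras]; last by rewrite /= clamp_id//; lra.
apply: le_trans (@norm_mxRintegral_delay_le _ _ _ _ h C K rho _ _ a_s _ _ bv _ vK _) _.
- exact: ltW.
- exact: bounded_measurable_clamp.
- by move=> r; exact: BC.
- move=> r; apply: Bd => //; apply: le_lt_trans (dist_clamp_le _ _ _ _) _.
  by rewrite opprB addrC subrK gtr0_norm.
have K0 : 0 <= K by apply: le_trans (vK s).
have : m%:R * rho * K * (s - a) <= m%:R * K * (b - a) * rho.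
  rewrite [leRHS](_ : _ = m%:R * rho * K * (b - a)); last ring.
  by rewrite ler_wpM2l ?mulr_ge0 ?(ltW rho0)//; lra.
have : 2 * (m%:R * C * K) * h <= 2 * (m%:R * C * K) * h'.
  by rewrite ler_wpM2l ?mulr_ge0// ge_min lexx orbT.
lra.
Qed.

End delay.

Section strategies.
Context {R : realType}.
Notation mu := (@lebesgue_measure R).
Implicit Types (a b h s t T e : R).

Lemma admissible_bounded_measurable p a b (V : set 'cV[R]_p) u : compact V ->
  admissible a b (fun=> V) u -> bounded_measurable `[a, b] u.
Proof.
move=> /compact_norm_bounded[M VM] [meas_u uV].
by apply: (bounded_measurable_col (M := M)) => // s sab; apply: VM; exact: uV.
Qed.

Lemma WsetP n m l (B : R -> 'M[R]_(n, m)) (E : R -> 'M[R]_(n, l)) U D s c :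
  Wset B E U D s c <-> forall d, D d -> mimage (B s) U (c - E s *m d).
Proof.
split=> [Wc d Dd|Wc _ [_ [_ [-> [[d Dd <-] ->]]]]].
  by apply: Wc; exists c, ((- E s) *m d); rewrite mulNmx; split=> //; split=> //;
    exists d => //; rewrite mulNmx.
by rewrite mulNmx; exact: Wc.
Qed.

Lemma Wset_convex n m l (B : R -> 'M[R]_(n, m)) (E : R -> 'M[R]_(n, l)) U D s :
  is_convex_set U -> is_convex_set (Wset B E U D s).
Proof.
move=> convU c c' /WsetP Wc /WsetP Wc' lam lam01; apply/WsetP => d Dd.
have [[u Uu uE] [u' Uu' uE']] := (Wc d Dd, Wc' d Dd).
exists (lam *: u + (1 - lam) *: u'); first exact: convU.
rewrite mulmxDr -!scalemxAr uE uE' !scalerBr addrACA -opprD -scalerDl.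
by rewrite [lam + _]addrC subrK scale1r.
Qed.

Lemma Wset_admissible_bounded_measurable n m l a b (B : R -> 'M[R]_(n, m))
    (E : R -> 'M[R]_(n, l)) U D w :
  bounded_measurable `[a, b] B -> bounded_measurable `[a, b] E ->
  compact U -> D !=set0 -> admissible a b (Wset B E U D) w ->
  bounded_measurable `[a, b] w.
Proof.
move=> bB bE /compact_norm_bounded[K UK] [d Dd] [mw wW].
have [MB MB0 BM] := bounded_measurable_operator_bound bB.
have [ME ME0 EM] := bounded_measurable_operator_bound bE.
apply: (bounded_measurable_col (M := MB * K + ME * `|d|)) => // s sab.
have /WsetP/(_ d Dd)[u Uu uE] := wW s sab.
rewrite -[w s](subrK (E s *m d)) -uE; apply: le_trans (ler_normD _ _) _.
apply: lerD; last exact: EM.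
by apply: le_trans (BM _ _ sab) _; rewrite ler_pM2l// UK.
Qed.

Lemma approximate_delayed_response n m l t T h rho (B : R -> 'M[R]_(n, m))
    (E : R -> 'M[R]_(n, l)) (U : set 'cV[R]_m) (D : set 'cV[R]_l) delta w :
  t <= T -> bounded_measurable `[t, T] B -> bounded_measurable `[t, T] E ->
  compact U -> U !=set0 -> compact D -> bounded_measurable `[t, T] w ->
  (forall s, t <= s <= T -> Wset B E U D s (w s)) ->
  nonanticipative t T U D delta -> 0 < h -> 0 < rho ->
  exists u v, [/\ admissible t T (fun=> U) u,
    bounded_measurable [set: R] v, forall r, U (v r),
    {ae mu, forall s, t <= s <= T -> u s = v (s - h)} &
    forall r, t <= r <= T -> `|B r *m v r - (w r - E r *m delta u r)| <= rho].
Proof.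
move=> tT bB bE cU U0 cD bw wW delta_na h0 rho0.
have [S [SU bS SP]] := approximate_selection (measurable_itv `[t, T]) bB cU U0 rho0.
have bresidual d : admissible t T (fun=> D) d ->
    bounded_measurable `[t, T] (fun r => S r (w r - E r *m d r)).
  move=> /(admissible_bounded_measurable cD) bd; apply: bS.
  by apply: bounded_measurableB => //; exact: bounded_measurableM.
have [u0 Uu0] := U0.
have [u adm_u uE] := delayed_response_exists tT h0 delta_na Uu0
  (fun r d => SU r (w r - E r *m d)) bresidual.
have adm_delta := delta_na.1 u adm_u.
exists u, (response t T u0 (fun r d => S r (w r - E r *m d)) delta u); split=> //.
- by apply: bounded_measurable_patch => //; exact: bresidual.
- by move=> r; rewrite /response /patch; case: ifP.
- move=> r rT; rewrite /response patchT; last by rewrite inE/= in_itv.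
  have /WsetP wWr := wW r rT.
  by apply: SP; [rewrite /= in_itv|apply: wWr; exact: adm_delta.2].
Qed.

Lemma strategy_cancellation n m l t T e (B : R -> 'M[R]_(n, m)) (E : R -> 'M[R]_(n, l))
    (U : set 'cV[R]_m) (D : set 'cV[R]_l) delta w :
  t <= T -> {within `[t, T], continuous B} -> bounded_measurable `[t, T] E ->
  compact U -> U !=set0 -> compact D -> bounded_measurable `[t, T] w ->
  (forall s, t <= s <= T -> Wset B E U D s (w s)) ->
  nonanticipative t T U D delta -> 0 < e ->
  exists2 u, admissible t T (fun=> U) u & forall s, t <= s <= T ->
    `|mxRintegral t s (fun r => B r *m u r + E r *m delta u r - w r)| <= e.
Proof.
move=> tT cB bE cU U0 cD bw wW delta_na e0.
have bB := within_continuous_bounded_measurable cB.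
have e20 : 0 < e / 2 by rewrite divr_gt0.
have [K UK] := compact_norm_bounded cU.
have [h h0 delay_small] := delay_effect_small K cB tT e20.
have [rho rho0 rho_le] := exists_mul_le (T - t) e20.
have [u [v [adm_u bv Uv uE v_near]]] :=
  approximate_delayed_response tT bB bE cU U0 cD bw wW delta_na h0 rho0.
exists u => // s sT; have [ts sT'] := andP sT.
have bu := admissible_bounded_measurable cU adm_u.
have bd := admissible_bounded_measurable cD (delta_na.1 u adm_u).
have bS p q (F : R -> 'M[R]_(p, q)) :
    bounded_measurable `[t, T] F -> bounded_measurable `[t, s] F.
  exact: bounded_measurable_segmentS.
have bvT : bounded_measurable `[t, T] v by exact: bounded_measurableS bv.
have bvh : bounded_measurable `[t, T] (fun r => v (r - h)).
  exact: bounded_measurableS (bounded_measurable_translation h bv).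
have bEd := bounded_measurableM bE bd.
have bdelay := bS _ _ _
  (bounded_measurableB (bounded_measurableM bB bvh) (bounded_measurableM bB bvT)).
have bnear := bS _ _ _
  (bounded_measurableB (bounded_measurableM bB bvT) (bounded_measurableB bw bEd)).
rewrite (@ae_eq_mxRintegral _ _ _ _ _ _ (fun r => (B r *m v (r - h) - B r *m v r) +
  (B r *m v r - (w r - E r *m delta u r)))); first last.
- by apply: filterS uE => r uEr rs; rewrite uEr; [rewrite addrA subrK opprB addrA|lra].
- exact: bounded_measurableD.
- apply: bS; apply: bounded_measurableB => //; apply: bounded_measurableD => //.
  exact: bounded_measurableM.
rewrite mxRintegralD// [e]splitr; apply: le_trans (ler_normD _ _) _.
apply: lerD; first by apply: delay_small => // r; exact: UK.
apply: le_trans (norm_mxRintegral_le ts bnear (M := rho) _) _ => [r rs|].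
  by apply: v_near; lra.
by apply: le_trans rho_le; rewrite mulrC ler_wpM2r ?(ltW rho0)//; lra.
Qed.

End strategies.

(** * The value bound *)

Section value_bound.
Context {R : realType}.
Implicit Types (e s t c : R).

Lemma le_scaled_ereal_inf (X : Type) (Y : set X) (f : X -> R) (V : \bar R) (L c : R) :
  0 <= L -> Y !=set0 -> (forall y, Y y -> (V <= (L * f y + c)%:E)%E) ->
  (V <= L%:E * ereal_inf [set (f y)%:E | y in Y] + c%:E)%E.
Proof.
move=> L0 [y0 Yy0] Vle; have [L_gt0|L_le0] := ltP 0 L; last first.
  have L_eq0 : L = 0 by lra.
  by have := Vle y0 Yy0; rewrite L_eq0 mul0e add0e mul0r add0r.
rewrite -leeBlDr// -ereal_inf_pZl//; apply: le_ereal_inf_tmp => _ [_ [y Yy <-] <-].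
by rewrite leeBlDr// -EFinM -EFinD; exact: Vle.
Qed.

Lemma linear_solution_is_traj n m l t T (A : R -> 'M[R]_n) (B : R -> 'M[R]_(n, m))
    (E : R -> 'M[R]_(n, l)) x u d xi :
  bounded_measurable `[t, T] A ->
  bounded_measurable `[t, T] (fun r => B r *m u r + E r *m d r) ->
  linear_solution t T A x (fun r => B r *m u r + E r *m d r) xi ->
  is_traj A B E t T x u d xi.
Proof.
move=> bA bf sol; split=> [|s sT i]; first exact: linear_solution_continuous sol.
have [ts _] := andP sT; rewrite sol.2// !mxE /oint ts; congr (_ + _).
by apply: eq_Rintegral => r _; rewrite addrA.
Qed.

Variables (n : nat) (T : R) (A : R -> 'M[R]_n).
Hypothesis bA : bounded_measurable `[0, T] A.

Let bA_from t : 0 <= t -> bounded_measurable `[t, T] A.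
Proof. by move=> t0; exact: bounded_measurable_segmentS bA. Qed.

Lemma state_transition_linear_solution Phi t z : 0 <= t <= T ->
  is_state_transition A T Phi ->
  linear_solution t T A z (fun=> 0) (fun s => Phi s t *m z).
Proof.
move=> tT /(_ t tT)[cPhi PhiE]; have [t0 _] := andP tT.
have bPhi : bounded_measurable `[t, T] (fun s => Phi s t).
  apply: (bounded_measurable_segmentS t0 (lexx T)).
  exact: within_continuous_bounded_measurable.
split=> [|s sT].
  by apply: bounded_measurableM => //; exact: bounded_measurable_cst.
have [ts sT'] := andP sT.
have -> : Phi s t = 1%:M + mxRintegral t s (fun r => A r *m Phi r t).
  by apply/matrixP => i j; rewrite PhiE ?mxE ?/oint ?ts//; lra.
rewrite mulmxDl mul1mx -mxRintegral_mulmxr; last first.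
  apply: (bounded_measurable_segmentS (lexx t) sT').
  by apply: bounded_measurableM => //; exact: bA_from.
by congr (_ + _); apply: eq_mxRintegral => r _; rewrite addr0 mulmxA.
Qed.

Lemma backward_traj_linear_solution xT w xi t : 0 <= t <= T ->
  bounded_measurable `[0, T] w -> is_backward_traj A T xT w xi ->
  linear_solution t T A (xi t) w xi /\ xi T = xT.
Proof.
move=> tT bw [cxi xiE]; have [t0 _] := andP tT.
have bxi := within_continuous_bounded_measurable cxi.
have brhs := bounded_measurableD (bounded_measurableM bA bxi) bw.
have {}xiE s : 0 <= s <= T -> xi s = xT - mxRintegral s T (fun r => A r *m xi r + w r).
  move=> sT; apply/colP => i; rewrite xiE// !mxE /oint; case: ifP => // Ts.
  by have -> : s = T by [lra]; rewrite !set_itv1 !Rintegral_set1 oppr0.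
split; last by rewrite xiE ?mxRintegral_point ?subr0//; lra.
split=> [|s sT]; first exact: bounded_measurable_segmentS bxi.
have [ts sT'] := andP sT; have s0T : 0 <= s <= T by lra.
rewrite (xiE s s0T) (xiE t tT).
rewrite /picard (@mxRintegral_cat _ _ _ t s T)//; last first.
  exact: bounded_measurable_segmentS brhs.
by rewrite opprD addrA addrAC subrK.
Qed.

Definition steerable_to_sublevel (W : R -> set 'cV[R]_n) (g : 'cV[R]_n -> R) t c :
    set 'cV[R]_n :=
  [set y | exists w zeta, [/\ bounded_measurable `[t, T] w,
    forall s, t <= s <= T -> W s (w s), linear_solution t T A y w zeta &
    g (zeta T) <= c]].

Lemma steerable_to_sublevel_convex W g t c : 0 <= t ->
  (forall s, is_convex_set (W s)) -> is_convex_fun g ->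
  is_convex_set (steerable_to_sublevel W g t c).
Proof.
move=> t0 convW convg y y' [w [zeta [bw wW sol gz]]] [w' [zeta' [bw' w'W sol' gz']]].
move=> lam lam01; have /andP[lam0 lam1] := lam01.
have [bZw bZw'] := (bounded_measurableZ lam bw, bounded_measurableZ (1 - lam) bw').
exists (fun r => lam *: w r + (1 - lam) *: w' r).
exists (fun r => lam *: zeta r + (1 - lam) *: zeta' r); split.
- exact: bounded_measurableD.
- by move=> s sT; apply: convW => //; [exact: wW|exact: w'W].
- have bAt := bA_from t0.
  have [solZ solZ'] :=
    (linear_solutionZ bAt lam bw sol, linear_solutionZ bAt (1 - lam) bw' sol').
  exact: (linear_solutionD bAt bZw bZw').
- apply: le_trans (convg _ _ _ lam01) _.
  have : lam * g (zeta T) <= lam * c by exact: ler_wpM2l.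
  have : (1 - lam) * g (zeta' T) <= (1 - lam) * c by apply: ler_wpM2l => //; lra.
  lra.
Qed.

End value_bound.

Section game.
Context {R : realType}.
Implicit Types (c e s t : R).

Lemma lipschitz_enorm_le n (g : 'cV[R]_n -> R) L (p q z : 'cV[R]_n) e : 0 <= L ->
  (forall x y, `|g x - g y| <= L * enorm (x - y)) -> `|p - (q + z)| <= e ->
  g p <= L * enorm z + g q + L * Num.sqrt n%:R * e.
Proof.
move=> L0 lipg pqz.
have g_near : g p - g (q + z) <= L * Num.sqrt n%:R * e.
  apply: le_trans (ler_norm _) (le_trans (lipg _ _) _); rewrite -mulrA ler_wpM2l//.
  by apply: le_trans (enorm_le_norm _) _; rewrite ler_wpM2l// sqrtr_ge0.
have : g (q + z) - g q <= L * enorm z.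
  by apply: le_trans (ler_norm _) (le_trans (lipg _ _) _); rewrite addrC addKr.
lra.
Qed.

Variables (n m l : nat) (T : R).
Variables (A : R -> 'M[R]_n) (B : R -> 'M[R]_(n, m)) (E : R -> 'M[R]_(n, l)).
Variables (U : set 'cV[R]_m) (D : set 'cV[R]_l) (Phi : R -> R -> 'M[R]_n).
Hypotheses (bA : bounded_measurable `[0, T] A).
Hypotheses (cB : {within `[0, T], continuous B}) (bE : bounded_measurable `[0, T] E).
Hypotheses (cU : compact U) (U0 : U !=set0) (cD : compact D).
Hypothesis Phi_transition : is_state_transition A T Phi.

Lemma strategy_steering t x y w zeta delta e : 0 <= t <= T ->
  bounded_measurable `[t, T] w -> (forall s, t <= s <= T -> Wset B E U D s (w s)) ->
  linear_solution t T A y w zeta -> nonanticipative t T U D delta -> 0 < e ->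
  exists u xi, [/\ admissible t T (fun=> U) u, is_traj A B E t T x u (delta u) xi &
    `|xi T - (zeta T + Phi T t *m (x - y))| <= e].
Proof.
move=> tT bw wW sol_zeta delta_na e0; have [t0 tT'] := andP tT.
have bS p q (F : R -> 'M[R]_(p, q)) :
    bounded_measurable `[0, T] F -> bounded_measurable `[t, T] F.
  exact: bounded_measurable_segmentS.
have cBt : {within `[t, T], continuous B}.
  exact: continuous_subspaceW (subset_segment t0 (lexx T)) cB.
have bBt := within_continuous_bounded_measurable cBt.
have [C C0 stable] := linear_solution_stable (bS _ _ _ bA).
have [u adm_u small] := strategy_cancellation tT' cBt (bS _ _ _ bE) cU U0 cD bw wW
  delta_na (divr_gt0 e0 C0).
have bf : bounded_measurable `[t, T] (fun r => B r *m u r + E r *m delta u r).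
  apply: bounded_measurableD; apply: bounded_measurableM => //.
  - exact: admissible_bounded_measurable adm_u.
  - exact: bS.
  - exact: admissible_bounded_measurable (delta_na.1 u adm_u).
have [xi sol_xi] := linear_solution_exists (bS _ _ _ bA) x bf.
exists u, xi; split=> //; first exact: linear_solution_is_traj (bS _ _ _ bA) bf sol_xi.
have b0 := bounded_measurable_cst `[t, T] (0 : 'cV[R]_n).
have sol_phi := state_transition_linear_solution bA (x - y) tT Phi_transition.
have := linear_solutionD (bS _ _ _ bA) bw b0 sol_zeta sol_phi.
rewrite addrC subrK => sol_sum.
rewrite (_ : e = C * (e / C)); last by rewrite mulrC divfK ?gt_eqF.
apply: (stable _ x _ _ _ _ _ bf _ sol_xi sol_sum) => //.
- by rewrite divr_ge0// ltW.
- exact: bounded_measurableD.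
- by move=> s sT; under eq_mxRintegral do rewrite addr0; exact: small.
- by lra.
Qed.

Definition guaranteed_cost (g : 'cV[R]_n -> R) t x delta : \bar R :=
  ereal_inf [set (g (xi T))%:E | xi in [set xi | exists u,
    admissible t T (fun=> U) u /\ is_traj A B E t T x u (delta u) xi]].

Lemma guaranteed_cost_le g L t x y c delta : 0 <= t <= T -> 0 <= L ->
  (forall x y, `|g x - g y| <= L * enorm (x - y)) ->
  steerable_to_sublevel T A (Wset B E U D) g t c y -> nonanticipative t T U D delta ->
  (guaranteed_cost g t x delta <= (L * enorm (Phi T t *m (x - y)) + c)%:E)%E.
Proof.
move=> tT L0 lipg [w [zeta [bw wW sol_zeta gz]]] delta_na.
apply/lee_addgt0Pr => e e0; have [d d0 d_le] := exists_mul_le (L * Num.sqrt n%:R) e0.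
have [u [xi [adm_u traj_xi xi_near]]] :=
  strategy_steering x tT bw wW sol_zeta delta_na d0.
apply: ge_ereal_inf; exists (g (xi T))%:E; first by exists xi => //; exists u.
by rewrite -EFinD lee_fin; have := lipschitz_enorm_le L0 lipg xi_near; lra.
Qed.

Lemma conv_hull_backward_steerable (I : Type) (xT : I -> 'cV[R]_n)
    (w xi : I -> R -> 'cV[R]_n) g t c :
  0 <= t <= T -> is_convex_set U -> D !=set0 -> is_convex_fun g ->
  (forall i, admissible 0 T (Wset B E U D) (w i)) ->
  (forall i, is_backward_traj A T (xT i) (w i) (xi i)) ->
  (forall i, g (xT i) <= c) ->
  conv_hull (range (fun i => xi i t)) `<=` steerable_to_sublevel T A (Wset B E U D) g t c.
Proof.
move=> tT convU D0 convg adm_w back_xi gxT y hull_y; have [t0 _] := andP tT.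
apply: hull_y; split.
  by apply: steerable_to_sublevel_convex => // s; exact: Wset_convex.
move=> _ [i _ <-]; have bB := within_continuous_bounded_measurable cB.
have bw := Wset_admissible_bounded_measurable bB bE cU D0 (adm_w i).
have [sol_xi xiT] := backward_traj_linear_solution bA tT bw (back_xi i).
exists (w i), (xi i); split=> //; last by rewrite xiT.
- exact: bounded_measurable_segmentS bw.
- by move=> s sT; apply: (adm_w i).2; lra.
Qed.

End game.
Theorem theorem3 (R : realType) (n m l : nat) (T : R)
  (A : R -> 'M[R]_n) (B : R -> 'M[R]_(n, m)) (E : R -> 'M[R]_(n, l))
  (U : set 'cV[R]_m) (D : set 'cV[R]_l) (g : 'cV[R]_n -> R) (Lg : R)
  (N : nat) (gam : 'I_N -> R) (nk : 'I_N -> nat)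
  (xbar : forall k : 'I_N, 'I_(nk k) -> 'cV[R]_n)
  (omega : forall k : 'I_N, 'I_(nk k) -> R -> 'cV[R]_n)
  (xis : forall k : 'I_N, 'I_(nk k) -> R -> 'cV[R]_n)
  (Phi : R -> R -> 'M[R]_n) :
  0 < T ->
  {within `[0, T], continuous A} ->
  {within `[0, T], continuous B} ->
  {within `[0, T], continuous E} ->
  compact U -> is_convex_set U -> U !=set0 ->
  compact D -> is_convex_set D -> D !=set0 ->
  continuous g ->
  (* (i) *)
  is_convex_fun g -> 0 <= Lg ->
  (forall x y, `|g x - g y| <= Lg * enorm (x - y)) ->
  (* (ii) *)
  (forall t, 0 <= t <= T -> Wset B E U D t !=set0) ->
  (0 < N)%N -> (forall k, 0 < nk k)%N ->
  (forall k, exists y, g y = gam k) ->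
  (forall k i, g (xbar k i) = gam k) ->
  (forall k i, admissible 0 T (Wset B E U D) (omega k i)) ->
  (forall k i, is_backward_traj A T (xbar k i) (omega k i) (xis k i)) ->
  is_state_transition A T Phi ->
  forall (t : R) (x : 'cV[R]_n), 0 <= t <= T ->
    (value A B E U D g T t x <= vbar Lg gam xis Phi T t x)%E.
Proof.
move=> _ cA cB cE cU convU U0 cD _ D0 _ convg L0 lipg _ _ nk0 _ gxbar adm_omega back_xis.
move=> Phi_transition t x tT.
have bA := within_continuous_bounded_measurable cA.
have bE := within_continuous_bounded_measurable cE.
apply: ge_ereal_sup => _ [delta delta_na <-]; apply: le_ereal_inf_tmp => _ [k _ <-].
apply: le_scaled_ereal_inf => // [|y hull_y].
  by exists (xis k (Ordinal (nk0 k)) t) => S [_]; apply; exists (Ordinal (nk0 k)).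
apply: (guaranteed_cost_le bA cB bE cU U0 cD Phi_transition) => //.
apply: (conv_hull_backward_steerable bA cB bE cU tT convU D0 convg
  (adm_omega k) (back_xis k)) => // i.
by rewrite gxbar.
Qed.
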